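(* Let $A=\varinjlim(A_i,\varphi_i)$ be a simple, unital, infinite-dimensional diagonal AH-algebra. Then $\lim_{i\to\infty}d_{A_i}=\infty$.
   Context: $M_m$ denotes $M_m(\mathbb{C})$ and $\mathbb{N}=\{1,2,\dots\}$. Diagonal maps. For compact Hausdorff spaces $X,Y$, a unital $*$-homomorphism $\varphi\colon C(X)\otimes M_m\to C(Y)\otimes M_{km}$ is called diagonal if there are continuous maps $\lambda_1,\dots,\lambda_k\colon Y\to X$ with $\varphi(f)=\mathrm{diag}(f\circ\lambda_1,\dots,f\circ\lambda_k)$ for all $f$ (identifying $C(X)\otimes M_m$ with $C(X,M_m)$). A unital $*$-homomorphism $\varphi\colon\bigoplus_{i=1}^n C(X_i)\otimes M_{m_i}\to C(Y)\otimes M_p$ is diagonal if there are integers $k_1,\dots,k_n\ge 0$ with $\sum_i k_im_i=p$ and diagonal maps ${}^i\varphi\colon C(X_i)\otimes M_{m_i}\to C(Y)\otimes M_{k_im_i}$ such that $\varphi=\mathrm{diag}({}^1\varphi,\dots,{}^n\varphi)$ (summands with $k_i=0$ are omitted from the block diagonal). A unital $*$-homomorphism $\bigoplus_{i=1}^n C(X_i)\otimes M_{m_i}\to\bigoplus_{j=1}^t C(Y_j)\otimes M_{p_j}$ is diagonal if each of its components into $C(Y_j)\otimes M_{p_j}$ is diagonal. Diagonal AH-algebras. An AH system with diagonal maps is an inductive system $(A_i,\varphi_i)_{i\in\mathbb{N}}$, $\varphi_i\colon A_i\to A_{i+1}$, where $A_i=\bigoplus_{l=1}^{n_i}C(X_{i,l})\otimes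 M_{m_{i,l}}$ with each $X_{i,l}$ a (nonempty) connected compact metric space, $n_i,m_{i,l}\in\mathbb{N}$, and each $\varphi_i$ is diagonal. All connecting maps $\varphi_i$ are assumed injective. A diagonal AH-algebra is a C*-algebra that is the inductive limit of such a system; writing $A=\varinjlim(A_i,\varphi_i)$ means that such a system with limit $A$ is fixed. For $C=\bigoplus_{i=1}^n C(X_i)\otimes M_{m_i}$ put $d_C=\min\{m_1,\dots,m_n\}$. *)

(* Defs.v *)
From HB Require Import structures.
From mathcomp Require Import all_boot all_order all_algebra.
From mathcomp Require Import complex.
From mathcomp Require Import all_classical all_reals all_analysis.

Set Implicit Arguments.
Unset Strict Implicit.
Unset Printing Implicit Defensive.

Import Order.TTheory GRing.Theory Num.Theory.
Import numFieldNormedType.Exports.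

Local Open Scope classical_set_scope.
Local Open Scope ring_scope.

(* Complex *-algebras.  No unit is required, hence a multiplication of our own
   rather than one of the (unital) rings of ssralg. *)
HB.mixin Record Lmodule_isStarAlgebra (C : numClosedFieldType) A
    & GRing.Lmodule C A := {
  samul : A -> A -> A;
  sastar : A -> A;
  samulA : forall a b c, samul a (samul b c) = samul (samul a b) c;
  samulDl : forall a b c, samul (a + b) c = samul a c + samul b c;
  samulDr : forall a b c, samul a (b + c) = samul a b + samul a c;
  samulZl : forall (x : C) a b, samul (x *: a) b = x *: samul a b;
  samulZr : forall (x : C) a b, samul a (x *: b) = x *: samul a b;
  sastarK : forall a, sastar (sastar a) = a;
  sastarD : forall a b, sastar (a + b) = sastar a + sastar b;
  sastarZ : forall (x : C) a, sastar (x *: a) = x^* *: sastar a;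
  sastarM : forall a b, sastar (samul a b) = samul (sastar b) (sastar a)
}.

#[short(type="starAlgType")]
HB.structure Definition StarAlgebra (C : numClosedFieldType) :=
  {A of GRing.Lmodule C A & Lmodule_isStarAlgebra C A}.

HB.mixin Record StarAlgebra_isCStarAlgebra (C : numClosedFieldType) A
    & CompleteNormedModule C A & StarAlgebra C A := {
  normr_samul_le : forall a b : A, `|samul a b| <= `|a| * `|b|;
  normr_cstar : forall a : A, `|samul (sastar a) a| = `|a| ^+ 2
}.

#[short(type="cstarAlgType")]
HB.structure Definition CStarAlgebra (C : numClosedFieldType) :=
  {A of CompleteNormedModule C A & StarAlgebra C A
   & StarAlgebra_isCStarAlgebra C A}.

Definition star_hom (C : numClosedFieldType) (A B : starAlgType C)
    (f : A -> B) : Prop :=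
  [/\ forall (x : C) a b, f (x *: a + b) = x *: f a + f b,
      forall a b, f (samul a b) = samul (f a) (f b)
    & forall a, f (sastar a) = sastar (f a)].

Definition is_unit (C : numClosedFieldType) (A : starAlgType C) (e : A) : Prop :=
  forall a, samul e a = a /\ samul a e = a.

Definition unital (C : numClosedFieldType) (A : starAlgType C) : Prop :=
  exists e : A, is_unit e.

Definition unital_star_hom (C : numClosedFieldType) (A B : starAlgType C)
    (f : A -> B) : Prop :=
  star_hom f /\ forall e, is_unit e -> is_unit (f e).

Definition finite_dimensional (C : numClosedFieldType) (A : lmodType C) : Prop :=
  exists s : seq A, forall a : A,
    exists c : 'I_(size s) -> C, a = \sum_(i < size s) c i *: s`_i.

Definition closed_two_sided_ideal (C : numClosedFieldType) (A : cstarAlgType C)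
    (I : set A) : Prop :=
  [/\ closed I, I 0,
      forall (x : C) a b, I a -> I b -> I (x *: a + b)
    & forall a b, I b -> I (samul a b) /\ I (samul b a)].

Definition simple_cstar (C : numClosedFieldType) (A : cstarAlgType C) : Prop :=
  (exists a : A, a != 0) /\
  forall I : set A, closed_two_sided_ideal I -> I = [set 0] \/ I = [set: A].

(* The inductive limit in the category of C*-algebras and *-homomorphisms, by
   its universal property.  The norms of the A_ i play no role in it: a
   *-algebra has at most one complete C*-norm, and *-homomorphisms between
   C*-algebras are automatically contractive. *)
Definition inductive_limit (C : numClosedFieldType) (A_ : nat -> starAlgType C)
    (phi : forall i, A_ i -> A_ i.+1)
    (A : cstarAlgType C) (mu : forall i, A_ i -> A) : Prop :=
  [/\ forall i, star_hom (mu i),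
      forall i a, mu i.+1 (phi i a) = mu i a
    & forall (B : cstarAlgType C) (nu : forall i, A_ i -> B),
        (forall i, star_hom (nu i)) ->
        (forall i a, nu i.+1 (phi i a) = nu i a) ->
        exists! psi : A -> B,
          star_hom psi /\ forall i a, psi (mu i a) = nu i a].

(* The data defining (+)_l C(X_l) (x) M_(m_l), for l < n and m_l >= 1. *)
Record block_data (R : realType) := BlockData {
  blk_count : nat;
  blk_space : 'I_blk_count -> metricType R;
  blk_size : 'I_blk_count -> nat;
  blk_count_gt0 : (0 < blk_count)%N;
  blk_size_gt0 : forall l, (0 < blk_size l)%N;
  blk_nonempty : forall l, [set: blk_space l] !=set0;
  blk_compact : forall l, compact [set: blk_space l];
  blk_connected : forall l, connected [set: blk_space l]
}.

Arguments blk_space {R} _ _.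
Arguments blk_size {R} _ _.

(* R[i] with its numClosedFieldType structure only (R[i] also has algebra
   structures over R). *)
Notation Cplx R := ((complex R : numClosedFieldType)) (only parsing).

(* C(X) (x) M_m is identified with C(X, M_m). *)
Definition block_alg (R : realType) (D : block_data R) : Type :=
  forall l : 'I_(blk_count D),
    continuousType (blk_space D l) 'M[Cplx R]_(blk_size D l).

Section BlockAlgebra.
Variables (R : realType) (D : block_data R).
Local Notation C := (Cplx R).
Implicit Types f g h : block_alg D.

HB.instance Definition _ := gen_eqMixin (block_alg D).
HB.instance Definition _ := gen_choiceMixin (block_alg D).

Lemma block_algP f g : (forall l x, f l x = g l x) -> f = g.
Proof.
move=> fg; apply: functional_extensionality_dep => l.
by apply/continuousEP => x; exact: fg.
Qed.

Lemma mx_continuousP (T : topologicalType) m n (f : T -> 'M[C]_(m, n)) :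
  (forall i j, continuous (fun x => f x i j)) -> continuous f.
Proof.
move=> fc x A [P fP PA].
have : \forall y \near x, forall i j, P i j (f y i j).
  apply: filter_forall => i; apply: filter_forall => j.
  exact: (fc i j x _ (fP i j)).
by apply: filterS => y Py; apply: PA.
Qed.

Lemma block_coord_continuous f l i j : continuous (fun x => f l x i j).
Proof.
move=> x; apply: (@continuous_comp _ _ _ (f l) (fun M : 'M[C]_(_, _) => M i j)).
  exact: cts_fun.
exact: coord_continuous.
Qed.

Fact block_zero_cts l :
  continuous (fun _ : blk_space D l => (0 : 'M[C]_(blk_size D l))).
Proof. by move=> x; exact: cvg_cst. Qed.

Fact block_one_cts l :
  continuous (fun _ : blk_space D l => (1%:M : 'M[C]_(blk_size D l))).
Proof. by move=> x; exact: cvg_cst. Qed.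

Fact block_opp_cts f l : continuous (fun x => - f l x).
Proof.
apply: mx_continuousP => i j x; under eq_fun do rewrite mxE.
by apply: cvgN; exact: block_coord_continuous.
Qed.

Fact block_add_cts f g l : continuous (fun x => f l x + g l x).
Proof.
apply: mx_continuousP => i j x; under eq_fun do rewrite mxE.
by apply: cvgD; exact: block_coord_continuous.
Qed.

Fact block_scale_cts (c : C) f l : continuous (fun x => c *: f l x).
Proof.
apply: mx_continuousP => i j x; under eq_fun do rewrite mxE.
by apply: cvgM; [exact: cvg_cst|exact: block_coord_continuous].
Qed.

Fact block_mul_cts f g l : continuous (fun x => f l x *m g l x).
Proof.
apply: mx_continuousP => i j x; under eq_fun do rewrite mxE.
apply: cvg_big => [|k _]; first exact: add_continuous.
by apply: cvgM; exact: block_coord_continuous.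
Qed.

Fact block_star_cts f l : continuous (fun x => map_mx Num.conj (f l x)^T).
Proof.
apply: mx_continuousP => i j x; under eq_fun do rewrite !mxE.
apply/cvgrPdist_lt => e e0; near=> y.
rewrite -rmorphB norm_conjC; near: y.
by move: e e0; apply/cvgrPdist_lt; exact: block_coord_continuous.
Unshelve. all: by end_near. Qed.

Definition block_zero : block_alg D := fun l => mkcts (@block_zero_cts l).
Definition block_one : block_alg D := fun l => mkcts (@block_one_cts l).
Definition block_opp f : block_alg D := fun l => mkcts (@block_opp_cts f l).
Definition block_add f g : block_alg D := fun l => mkcts (@block_add_cts f g l).
Definition block_scale (c : C) f : block_alg D :=
  fun l => mkcts (@block_scale_cts c f l).
Definition block_mul f g : block_alg D := fun l => mkcts (@block_mul_cts f g l).
Definition block_star f : block_alg D := fun l => mkcts (@block_star_cts f l).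

Fact block_addA : associative block_add.
Proof. by move=> f g h; apply: block_algP => l x /=; rewrite /mkcts addrA. Qed.
Fact block_addC : commutative block_add.
Proof. by move=> f g; apply: block_algP => l x /=; rewrite /mkcts addrC. Qed.
Fact block_add0 : left_id block_zero block_add.
Proof. by move=> f; apply: block_algP => l x /=; rewrite /mkcts add0r. Qed.
Fact block_addN : left_inverse block_zero block_opp block_add.
Proof. by move=> f; apply: block_algP => l x /=; rewrite /mkcts addNr. Qed.

HB.instance Definition _ := GRing.isZmodule.Build (block_alg D)
  block_addA block_addC block_add0 block_addN.

Fact block_scaleA (a b : C) f :
  block_scale a (block_scale b f) = block_scale (a * b) f.
Proof. by apply: block_algP => l x /=; rewrite /mkcts scalerA. Qed.
Fact block_scale1 : left_id 1 block_scale.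
Proof. by move=> f; apply: block_algP => l x /=; rewrite /mkcts scale1r. Qed.
Fact block_scaleDr : right_distributive block_scale +%R.
Proof. by move=> a f g; apply: block_algP => l x /=; rewrite /mkcts scalerDr. Qed.
Fact block_scaleDl f : {morph block_scale^~ f : a b / a + b}.
Proof. by move=> a b; apply: block_algP => l x /=; rewrite /mkcts scalerDl. Qed.

HB.instance Definition _ := GRing.Zmodule_isLmodule.Build C (block_alg D)
  block_scaleA block_scale1 block_scaleDr block_scaleDl.

Fact block_mulA f g h : block_mul f (block_mul g h) = block_mul (block_mul f g) h.
Proof. by apply: block_algP => l x /=; rewrite /mkcts mulmxA. Qed.
Fact block_mulDl f g h : block_mul (f + g) h = block_mul f h + block_mul g h.
Proof. by apply: block_algP => l x /=; rewrite /mkcts mulmxDl. Qed.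
Fact block_mulDr f g h : block_mul f (g + h) = block_mul f g + block_mul f h.
Proof. by apply: block_algP => l x /=; rewrite /mkcts mulmxDr. Qed.
Fact block_mulZl (c : C) f g : block_mul (c *: f) g = c *: block_mul f g.
Proof. by apply: block_algP => l x /=; rewrite /mkcts scalemxAl. Qed.
Fact block_mulZr (c : C) f g : block_mul f (c *: g) = c *: block_mul f g.
Proof. by apply: block_algP => l x /=; rewrite /mkcts scalemxAr. Qed.
Fact block_starK f : block_star (block_star f) = f.
Proof.
by apply: block_algP => l x; apply/matrixP => i j; rewrite /= /mkcts !mxE conjCK.
Qed.
Fact block_starD f g : block_star (f + g) = block_star f + block_star g.
Proof.
by apply: block_algP => l x; apply/matrixP => i j; rewrite /= /mkcts !mxE rmorphD.
Qed.
Fact block_starZ (c : C) f : block_star (c *: f) = c^* *: block_star f.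
Proof.
by apply: block_algP => l x; apply/matrixP => i j; rewrite /= /mkcts !mxE rmorphM.
Qed.
Fact block_starM f g :
  block_star (block_mul f g) = block_mul (block_star g) (block_star f).
Proof.
by apply: block_algP => l x; rewrite /= /mkcts trmx_mul map_mxM.
Qed.

HB.instance Definition _ := Lmodule_isStarAlgebra.Build C (block_alg D)
  block_mulA block_mulDl block_mulDr block_mulZl block_mulZr
  block_starK block_starD block_starZ block_starM.

Lemma block_one_unit : is_unit (block_one : block_alg D).
Proof.
by move=> f; split; apply: block_algP => l x; rewrite /= /mkcts ?mul1mx ?mulmx1.
Qed.

End BlockAlgebra.

(* The minimum of the m_l; the starting value \max_l m_l does not affect it
   since there is at least one block. *)
Definition min_blk_size (R : realType) (D : block_data R) : nat :=
  \big[minn/(\max_(l < blk_count D) blk_size D l)%N]_(l < blk_count D)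
    blk_size D l.

(* In the component of index j, the inner block diagonal matrix
   diag(f_l o lam_1, .., f_l o lam_(k_l)) has size \sum_(r < k l) m_l, that is
   k_l m_l, so e reads \sum_l k_l m_l = p_j; it has size 0 if k_l = 0. *)
Definition diagonal_hom (R : realType) (D E : block_data R)
    (phi : block_alg D -> block_alg E) : Prop :=
  unital_star_hom phi /\
  forall j : 'I_(blk_count E),
  exists (k : 'I_(blk_count D) -> nat)
         (e : (\sum_(l < blk_count D) \sum_(r < k l) blk_size D l)%N
              = blk_size E j)
         (lam : forall l, 'I_(k l) ->
                  continuousType (blk_space E j) (blk_space D l)),
  forall (f : block_alg D) (y : blk_space E j),
    phi f j y = castmx (e, e)
      (\mxdiag_(l < blk_count D) (\mxdiag_(r < k l) f l (lam l r y))).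

Record diagonal_ah_system (R : realType) := DiagonalAHSystem {
  ah_data : nat -> block_data R;
  ah_map : forall i, block_alg (ah_data i) -> block_alg (ah_data i.+1);
  ah_map_diagonal : forall i, diagonal_hom (@ah_map i);
  ah_map_inj : forall i, injective (@ah_map i)
}.

Definition ah_stage (R : realType) (S : diagonal_ah_system R) (i : nat) :
    starAlgType (Cplx R) :=
  block_alg (ah_data S i).

(* Main.v *)
(** If the minimal block sizes do not tend to infinity, then some d is the size
    of a block of A_n for infinitely many n.  For each such n, composing
    A_i -> A_n with evaluation at a point of that block gives a unital
    *-homomorphism A_i -> M_d.  Since the connecting maps are diagonal, the
    entries of the image of f are bounded by those of f, uniformly in n, so
    these homomorphisms converge along an ultrafilter on the n's; the limits are
    compatible with the connecting maps and yield a nonzero *-homomorphism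
    psi : A -> M_d.  The closure of ker psi is a closed ideal.  It is not A, as
    otherwise ker psi would contain an invertible element; hence psi is
    injective and A is finite-dimensional. *)
Require Import Defs.
From HB Require Import structures.
From mathcomp Require Import all_boot all_order all_algebra.
From mathcomp Require Import complex ring.
From mathcomp Require Import all_classical all_reals all_analysis.

Set Implicit Arguments.
Unset Strict Implicit.
Unset Printing Implicit Defensive.

Import Order.TTheory GRing.Theory Num.Theory.
Import numFieldNormedType.Exports.

Local Open Scope classical_set_scope.
Local Open Scope ring_scope.

(** * Limits along ultrafilters *)

(** For every set [A], the ultrafilter contains the preimage of [A] or its complement, so the image
    filter has no proper refinement. *)
Lemma ultra_map (T U : Type) (F : set_system T) (f : T -> U) :
  UltraFilter F -> UltraFilter (f @ F).
Proof.
move=> FU; split=> [|G GF FG]; first exact: fmap_proper_filter.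
apply/seteqP; split => // A GA.
have [//|FnA] := in_ultra_setVsetC (f @^-1` A) FU.
have : G (~` A) by exact: FG.
by move=> /(filterI GA); rewrite setICr => /filter_not_empty.
Qed.

(** The image ultrafilter contains the compact segment from [- B] to [B], hence converges there. *)
Lemma bounded_ultra_cvg_real (R : realType) (T : Type) (F : set_system T)
    (u : T -> R) (B : R) : UltraFilter F ->
  (\forall x \near F, `|u x| <= B) -> cvg (u @ F).
Proof.
move=> FU uB; have := @segment_compact R (- B) B.
rewrite compact_ultra => /(_ _ (ultra_map u FU)) [].
  by apply: filterS uB => x /=; rewrite in_itv /= ler_norml.
by move=> l [_ ul]; apply/cvg_ex; exists l.
Qed.

Lemma bounded_ultra_cvg (R : realType) (T : Type) (F : set_system T)
    (u : T -> Cplx R) (B : Cplx R) : UltraFilter F ->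
  (\forall x \near F, `|u x| <= B) -> cvg (u @ F).
Proof.
move=> FU uB.
have cRe : cvg ((fun x => complex.Re (u x)) @ F).
  apply: (@bounded_ultra_cvg_real _ _ _ _ (complex.Re B)).
  apply: filterS uB => x /(le_trans (normc_ge_Re _)).
  by rewrite lecE /= => /andP[].
have cIm : cvg ((fun x => complex.Im (u x)) @ F).
  apply: (@bounded_ultra_cvg_real _ _ _ _ (complex.Re B)).
  apply: filterS uB => x; rewrite normc_def lecE /= => /andP[_]; apply: le_trans.
  by rewrite -sqrtr_sqr ler_sqrt ?addr_ge0 ?sqr_ge0// lerDr sqr_ge0.
set a := lim (_ @ F) in cRe; set b := lim (_ @ F) in cIm.
apply/cvg_ex; exists (Complex a b); apply/cvgrPdist_lt => e e0.
(* In the order of the complex numbers [0 < e] forces [e] to be real; the real and the imaginary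
   part each get half of it. *)
have e20 : 0 < complex.Re e / 2.
  by move: e0; rewrite ltcE /= => /andP[_ ?]; rewrite divr_gt0.
have eE : e = (complex.Re e / 2 + complex.Re e / 2)%:C%C.
  by rewrite -splitr RRe_real// gtr0_real.
move/cvgrPdist_lt: cRe => /(_ _ e20) cRe; move/cvgrPdist_lt: cIm => /(_ _ e20).
apply: filterS2 cRe => x xa xb.
have -> : Complex a b - u x
    = (a - complex.Re (u x))%:C%C + 'i%C * (b - complex.Im (u x))%:C%C.
  by rewrite [LHS]complexE !raddfB.
have normR (r : R) : `|r%:C%C| = `|r|%:C%C.
  by rewrite normc_def /= expr0n/= addr0 sqrtr_sqr.
have normi : `|'i%C : Cplx R| = 1.
  by rewrite normc_def /= expr0n expr1n/= add0r sqrtr1.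
rewrite (le_lt_trans (ler_normD _ _))// normrM normi mul1r eE !normR.
by rewrite -rmorphD ltcR ltrD.
Qed.

(** * The operator norm on matrices *)

Section HermitianNorm.
Variables (R : realType) (n : nat).
Local Notation C := (Cplx R).
Local Notation adj M := (map_mx Num.conj M^T).
Implicit Types (u v : 'rV[C]_n) (M N : 'M[C]_n).

Definition hnorm v : C := sqrtC (dotmx v v).

Lemma hnorm_ge0 v : 0 <= hnorm v.
Proof. by rewrite sqrtC_ge0 dnorm_ge0. Qed.

Lemma hnorm_sqr v : hnorm v ^+ 2 = dotmx v v.
Proof. by rewrite sqrtCK. Qed.

Lemma hnormZ (a : C) v : hnorm (a *: v) = `|a| * hnorm v.
Proof.
by rewrite /hnorm dnormZ sqrtCM ?nnegrE ?exprn_ge0 ?dnorm_ge0// exprCK.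
Qed.

Lemma hnormD u v : hnorm (u + v) <= hnorm u + hnorm v.
Proof. exact: (triangle_lerif (@dotmx C n)). Qed.

Lemma hnorm0 : hnorm 0 = 0.
Proof. by apply/eqP; rewrite sqrtC_eq0 dnorm_eq0. Qed.

Lemma hnorm_eq0 v : hnorm v = 0 -> v = 0.
Proof. by move/eqP; rewrite sqrtC_eq0 dnorm_eq0 => /eqP. Qed.

Lemma dotmx_le u v : `|dotmx u v| <= hnorm u * hnorm v.
Proof. exact: (CauchySchwarz_sqrt (@dotmx C n)). Qed.

Lemma dotmx_adj u v M : dotmx (u *m M) v = dotmx u (v *m adj M).
Proof.
by rewrite !dotmxE trmx_mul map_mxM trmxCK mulmxA.
Qed.

Lemma hnorm_delta i : hnorm (delta_mx 0 i) = 1.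
Proof.
by rewrite /hnorm dotmxE -rowE !mxE !eqxx/= rmorph1 sqrtC1.
Qed.

Lemma coord_le_hnorm v i : `|v 0 i| <= hnorm v.
Proof.
have -> : v 0 i = dotmx v (delta_mx 0 i).
  rewrite dotmxE trmx_delta map_delta_mx -colE mxE//.
by rewrite (le_trans (dotmx_le _ _))// hnorm_delta mulr1.
Qed.

Lemma hnorm_le_sum v : hnorm v <= \sum_i `|v 0 i|.
Proof.
rewrite {1}[v]row_sum_delta; elim/big_ind2: _ => [|x a y b xa yb|i _].
- by rewrite hnorm0.
- by rewrite (le_trans (hnormD _ _))// lerD.
- by rewrite hnormZ hnorm_delta mulr1.
Qed.

(** This crude bound makes the supremum in [opnorm] finite and lets entrywise limits control the
    operator norm. *)
Lemma hnorm_mul_le_sum v M : hnorm v <= 1 ->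
  hnorm (v *m M) <= \sum_j \sum_i `|M i j|.
Proof.
move=> v1; rewrite (le_trans (hnorm_le_sum _))//; apply: ler_sum => j _.
rewrite mxE (le_trans (ler_norm_sum _ _ _))//; apply: ler_sum => i _.
by rewrite normrM ler_piMl// (le_trans (coord_le_hnorm v i)).
Qed.

End HermitianNorm.

(** The supremum is formed in [R], where completeness provides it, and cast back because norms over
    [Cplx R] take values in [Cplx R]. Matrices act on row vectors from the right. *)
HB.lock Definition opnorm (R : realType) n (M : 'M[Cplx R]_n) : Cplx R :=
  (sup [set complex.Re (hnorm (v *m M)) | v in [set v | hnorm v <= 1]])%:C%C.
Canonical opnorm_unlockable := Unlockable opnorm.unlock.

Section OperatorNorm.
Variables (R : realType) (n : nat).
Local Notation C := (Cplx R).
Local Notation adj M := (map_mx Num.conj M^T).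
Implicit Types (u v : 'rV[C]_n) (M N : 'M[C]_n).

Lemma opnorm_le M (c : C) :
  (forall v, hnorm v <= 1 -> hnorm (v *m M) <= c) -> opnorm M <= c.
Proof.
(* The vector 0 shows that [c] is nonnegative, hence real, so the comparison can be made in [R]. *)
move=> Mc; have c0 : 0 <= c.
  by have := Mc 0; rewrite mul0mx hnorm0; apply.
rewrite -(RRe_real (ger0_real c0)) unlock lecR; apply: ge_sup.
  by exists (complex.Re (hnorm (0 *m M))), 0 => //=; rewrite hnorm0.
by move=> _ [v /= v1 <-]; move: (Mc v v1); rewrite lecE => /andP[].
Qed.

Lemma opnorm_ub1 M v : hnorm v <= 1 -> hnorm (v *m M) <= opnorm M.
Proof.
move=> v1; rewrite -(RRe_real (ger0_real (hnorm_ge0 _))) unlock lecR.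
apply: ub_le_sup; last by exists v.
exists (complex.Re (\sum_j \sum_i `|M i j|)) => _ [w /= w1 <-].
by move: (hnorm_mul_le_sum M w1); rewrite lecE => /andP[].
Qed.

Lemma opnorm_ge0 M : 0 <= opnorm M.
Proof. by rewrite (le_trans (hnorm_ge0 (0 *m M)))// opnorm_ub1// hnorm0. Qed.

Lemma opnorm_ub M v : hnorm (v *m M) <= opnorm M * hnorm v.
Proof.
have [->|v0] := eqVneq v 0; first by rewrite mul0mx hnorm0 mulr0.
have hv : 0 < hnorm v.
  by rewrite lt_def hnorm_ge0 andbT; apply: contra_neq v0; exact: hnorm_eq0.
rewrite -ler_pdivrMr// mulrC.
have -> : (hnorm v)^-1 * hnorm (v *m M) = hnorm (((hnorm v)^-1 *: v) *m M).
  by rewrite -scalemxAl hnormZ ger0_norm// invr_ge0 ltW.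
apply: opnorm_ub1; rewrite hnormZ ger0_norm ?mulVf ?gt_eqF//.
by rewrite invr_ge0 ltW.
Qed.

Lemma opnormD M N : opnorm (M + N) <= opnorm M + opnorm N.
Proof.
apply: opnorm_le => v v1; rewrite mulmxDr (le_trans (hnormD _ _))//.
by rewrite lerD// opnorm_ub1.
Qed.

Lemma opnormM M N : opnorm (M *m N) <= opnorm M * opnorm N.
Proof.
apply: opnorm_le => v v1; rewrite mulmxA (le_trans (opnorm_ub _ _))// mulrC.
by rewrite ler_wpM2r ?opnorm_ge0// opnorm_ub1.
Qed.

Lemma opnormZ (a : C) M : opnorm (a *: M) = `|a| * opnorm M.
Proof.
have le b N : opnorm (b *: N) <= `|b| * opnorm N.
  apply: opnorm_le => v v1; rewrite -scalemxAr hnormZ ler_wpM2l//.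
  exact: opnorm_ub1.
apply/eqP; rewrite eq_le le/=.
have [->|a0] := eqVneq a 0; first by rewrite normr0 mul0r opnorm_ge0.
(* The reverse inequality is [le] for the scalar [a^-1] and the matrix [a *: M]. *)
rewrite -ler_pdivlMl ?normr_gt0// -normfV.
by have := le a^-1 (a *: M); rewrite scalerA mulVf// scale1r.
Qed.

Lemma entry_le_opnorm M i j : `|M i j| <= opnorm M.
Proof.
have -> : M i j = ((delta_mx 0 i : 'rV[C]_n) *m M) 0 j by rewrite -rowE mxE.
by rewrite (le_trans (coord_le_hnorm _ _))// opnorm_ub1// hnorm_delta.
Qed.

Lemma opnorm_le_sum M : opnorm M <= \sum_j \sum_i `|M i j|.
Proof. by apply: opnorm_le => v; exact: hnorm_mul_le_sum. Qed.

Lemma opnorm_eq0 M : opnorm M = 0 -> M = 0.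
Proof.
move=> M0; apply/matrixP => i j; rewrite mxE; apply/eqP.
by rewrite -normr_le0 -M0 entry_le_opnorm.
Qed.

(* [|v M|^2 = <v M M^*, v>] *)
Lemma opnorm_sqr_le M : opnorm M ^+ 2 <= opnorm (M *m adj M).
Proof.
rewrite -[leRHS]sqrtCK ler_pXn2r ?nnegrE ?opnorm_ge0 ?sqrtC_ge0 ?opnorm_ge0//.
apply: opnorm_le => v v1.
rewrite -(ler_pXn2r (ltn0Sn 1)) ?nnegrE ?hnorm_ge0 ?sqrtC_ge0 ?opnorm_ge0//.
rewrite hnorm_sqr sqrtCK dotmx_adj -mulmxA.
rewrite -[leLHS]ger0_norm; last first.
  by rewrite mulmxA -dotmx_adj dnorm_ge0.
rewrite (le_trans (dotmx_le _ _))// -[leRHS]mul1r ler_pM ?hnorm_ge0//.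
exact: opnorm_ub1.
Qed.

(** One factor [opnorm (adj M)] cancels in [opnorm (adj M) ^+ 2 <= opnorm (adj M *m M) <= opnorm
    (adj M) * opnorm M]. *)
Lemma opnorm_adj_le M : opnorm (adj M) <= opnorm M.
Proof.
have := le_trans (opnorm_sqr_le (adj M)) (opnormM _ _); rewrite trmxCK expr2.
have [->|M0] := eqVneq (opnorm (adj M)) 0; first by rewrite opnorm_ge0.
by rewrite ler_pM2l// lt_def M0 opnorm_ge0.
Qed.

Lemma opnorm_cstar M : opnorm (adj M *m M) = opnorm M ^+ 2.
Proof.
have adjE : opnorm (adj M) = opnorm M.
  apply/eqP; rewrite eq_le opnorm_adj_le/=.
  by have := opnorm_adj_le (adj M); rewrite trmxCK.
apply/eqP; rewrite eq_le -{2}adjE; apply/andP; split.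
  by rewrite (le_trans (opnormM _ _))// adjE.
by have := opnorm_sqr_le (adj M); rewrite trmxCK.
Qed.

End OperatorNorm.

(** A separate name for the matrices, so that they carry the operator norm: the entrywise maximum
    norm of ['M[Cplx R]_n] violates the C*-identity in general. *)
Definition opmx (R : realType) n : Type := 'M[Cplx R]_n.

Section OperatorAlgebra.
Variables (R : realType) (n : nat).
Local Notation C := (Cplx R).
Local Notation A := (opmx R n).

HB.instance Definition _ := GRing.Lmodule.copy A 'M[C]_n.

HB.instance Definition _ := Lmodule_isNormed.Build C A
  (@opnormD R n) (@opnormZ R n) (@opnorm_eq0 R n).

Lemma opmx_linE (c : C) (M N : A) i j :
  (c *: M + N) i j = c * M i j + N i j.
Proof.
by rewrite -[LHS]/((c *: (M : 'M[C]_n) + (N : 'M[C]_n)) i j) !mxE.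
Qed.

Lemma opmx_normE (M : A) : `|M| = opnorm M. Proof. by []. Qed.

Lemma opmx_entry_le (M : A) i j : `|M i j : C| <= `|M|.
Proof. exact: entry_le_opnorm. Qed.

Lemma opmx_cvg_entries (T : Type) (F : set_system T) (FF : Filter F)
    (u : T -> A) (L : A) :
  (forall i j, (fun x => u x i j : C) @ F --> (L i j : C)) -> u @ F --> L.
Proof.
move=> uL; apply/cvgrPdist_lt => e e0.
have : (fun x => \sum_j \sum_i `|L i j - u x i j|) @ F
    --> (\sum_(j < n) \sum_(i < n) 0 : C).
  apply: cvg_big => [|j _]; first exact: add_continuous.
  apply: cvg_big => [|i _]; first exact: add_continuous.
  rewrite -(normr0 C) -(subrr (L i j)).
  by apply: cvg_norm; apply: cvgB; [exact: cvg_cst|exact: uL].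
rewrite big1 => [|j _]; last by rewrite big1.
move=> /cvgrPdist_lt/(_ _ e0); apply: filterS => x; rewrite sub0r normrN.
rewrite ger0_norm ?sumr_ge0// => [|j _]; last by rewrite sumr_ge0.
apply: le_lt_trans; rewrite opmx_normE (le_trans (opnorm_le_sum _))//.
by under eq_bigr do under eq_bigr do rewrite !mxE.
Qed.

(** The entries are bounded on a member of the Cauchy filter, so they converge along a finer
    ultrafilter [G]; a Cauchy filter converges to the limit of any finer proper filter. *)
Lemma opmx_complete (F : set_system A) : ProperFilter F -> cauchy F -> cvg F.
Proof.
move=> FF /cauchyP Fc; have [G [GU FG]] := ultraFilterLemma FF.
have Gc i j : cvg ((fun M : A => M i j : C) @ G).
  have [M0 FM0] := Fc 1 ltr01.
  apply: (@bounded_ultra_cvg _ _ _ _ (`|M0| + 1)); apply: FG.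
  apply: filterS FM0 => M; rewrite -ball_normE /= => M0M.
  rewrite (le_trans (opmx_entry_le M i j))// -lerBlDl.
  by rewrite (le_trans (lerB_dist _ _))// distrC ltW.
pose L : A := \matrix_(i, j) lim ((fun M : A => M i j : C) @ G).
have GL : (id : A -> A) @ G --> L.
  by apply: opmx_cvg_entries => i j; rewrite mxE; exact: Gc.
apply/cvg_ex; exists L; apply/(@cvgrPdist_lt _ _ _ F _ id) => e e0.
have e20 : 0 < e / 2 by rewrite divr_gt0.
have e40 : 0 < e / 2 / 2 by rewrite divr_gt0.
have [M FM] := Fc _ e40; apply: filterS (FM) => N; rewrite -ball_normE /= => MN.
move/cvgrPdist_lt: GL => /(_ _ e20) => GL.
(* [P] is within [e / 2] of [L] and within [e / 4] of the centre [M], which links [L] to [N]. *)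
have [P [LP]] := filter_ex (filterI GL (FG _ FM)).
rewrite -ball_normE /= => MP.
rewrite -(subrK P L) -addrA (le_lt_trans (ler_normD _ _))// (splitr e) ltrD//.
rewrite -(subrK M P) -addrA (le_lt_trans (ler_normD _ _))// (splitr (e / 2)).
by rewrite ltrD// distrC.
Qed.

HB.instance Definition _ := Uniform_isComplete.Build A opmx_complete.

Definition opmx_mul (M N : A) : A := (M : 'M[C]_n) *m N.
Definition opmx_star (M : A) : A := map_mx Num.conj (M : 'M[C]_n)^T.

Fact opmx_mulA M N P : opmx_mul M (opmx_mul N P) = opmx_mul (opmx_mul M N) P.
Proof. exact: mulmxA. Qed.
Fact opmx_mulDl M N P : opmx_mul (M + N) P = opmx_mul M P + opmx_mul N P.
Proof. exact: mulmxDl. Qed.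
Fact opmx_mulDr M N P : opmx_mul M (N + P) = opmx_mul M N + opmx_mul M P.
Proof. exact: mulmxDr. Qed.
Fact opmx_mulZl (c : C) M N : opmx_mul (c *: M) N = c *: opmx_mul M N.
Proof. by apply/esym; exact: scalemxAl. Qed.
Fact opmx_mulZr (c : C) M N : opmx_mul M (c *: N) = c *: opmx_mul M N.
Proof. by apply/esym; exact: scalemxAr. Qed.
Fact opmx_starK M : opmx_star (opmx_star M) = M.
Proof. exact: trmxCK. Qed.
Fact opmx_starD M N : opmx_star (M + N) = opmx_star M + opmx_star N.
Proof. by apply/matrixP => i j; rewrite !mxE rmorphD. Qed.
Fact opmx_starZ (c : C) M : opmx_star (c *: M) = c^* *: opmx_star M.
Proof. by apply/matrixP => i j; rewrite !mxE rmorphM. Qed.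
Fact opmx_starM M N :
  opmx_star (opmx_mul M N) = opmx_mul (opmx_star N) (opmx_star M).
Proof. by rewrite /opmx_star trmx_mul map_mxM. Qed.

HB.instance Definition _ := Lmodule_isStarAlgebra.Build C A
  opmx_mulA opmx_mulDl opmx_mulDr opmx_mulZl opmx_mulZr
  opmx_starK opmx_starD opmx_starZ opmx_starM.

HB.instance Definition _ := StarAlgebra_isCStarAlgebra.Build C A
  (@opnormM R n) (@opnorm_cstar R n).

End OperatorAlgebra.

(** * Kernels of *-homomorphisms *)

Lemma star_hom0 (C : numClosedFieldType) (A B : starAlgType C) (f : A -> B) :
  star_hom f -> f 0 = 0.
Proof.
move=> [fL _ _]; have := fL 1 0 0; rewrite !scale1r addr0 => f00.
by apply: (addrI (f 0)); rewrite -f00 addr0.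
Qed.

Lemma samul0r (C : numClosedFieldType) (A : starAlgType C) (a : A) :
  samul a 0 = 0.
Proof. by apply: (addrI (samul a 0)); rewrite -samulDr !addr0. Qed.

Lemma samul0l (C : numClosedFieldType) (A : starAlgType C) (a : A) :
  samul 0 a = 0.
Proof. by apply: (addrI (samul 0 a)); rewrite -samulDl !addr0. Qed.

Lemma lipschitz_continuous (K : numFieldType) (V W : normedModType K)
    (f : V -> W) (c : K) : 0 <= c ->
  (forall x y, `|f x - f y| <= c * `|x - y|) -> continuous f.
Proof.
move=> c0 fc x; apply/cvgrPdist_lt => e e0.
have c1 : 0 < c + 1 by rewrite ltr_wpDl.
have ec : 0 < e / (c + 1) by rewrite divr_gt0.
apply: filterS (nbhsx_ballx x _ ec) => y; rewrite -ball_normE /= => xy.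
rewrite (le_lt_trans (fc _ _))//.
rewrite (@le_lt_trans _ _ ((c + 1) * `|x - y|))//.
  by rewrite ler_wpM2r// lerDl.
by rewrite mulrC -ltr_pdivlMr.
Qed.

(** This carries each ideal property of a kernel over to its closure. *)
Lemma continuous_closure_sub (T U : topologicalType) (f : T -> U)
    (K : set T) (S : set U) : continuous f -> closed S ->
  (forall x, K x -> S (f x)) -> forall x, closure K x -> S (f x).
Proof.
move=> fc Scl KS x Kx; have -> : S = closure S by exact/closure_id.
by move=> V /fc /Kx [y [/KS Sfy Vy]]; exists (f y).
Qed.

Section CStarAlgebra.
Variables (C : numClosedFieldType) (A : cstarAlgType C).

Lemma samulBr (a b c : A) : samul a (b - c) = samul a b - samul a c.
Proof. by rewrite samulDr -scaleN1r samulZr scaleN1r. Qed.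

Lemma samulBl (a b c : A) : samul (b - c) a = samul b a - samul c a.
Proof. by rewrite samulDl -scaleN1r samulZl scaleN1r. Qed.

Lemma samull_continuous (a : A) : continuous (samul a).
Proof.
apply: (lipschitz_continuous (normr_ge0 a)) => x y.
by rewrite -samulBr normr_samul_le.
Qed.

Lemma samulr_continuous (a : A) : continuous (samul^~ a).
Proof.
apply: (lipschitz_continuous (normr_ge0 a)) => x y.
by rewrite -samulBl mulrC normr_samul_le.
Qed.

(** The target is merely a *-algebra, so the kernel need not be closed. Its closure is still an
    ideal, since the operations of [A] are continuous in each variable. *)
Lemma closure_kernel_ideal (B : starAlgType C) (f : A -> B) : star_hom f ->
  closed_two_sided_ideal (closure [set a | f a = 0]).
Proof.
move=> fh; have f0 := star_hom0 fh; case: fh => fL fM _.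
set K := [set a | f a = 0].
have clK := @closed_closure A K; have subK := @subset_closure A K.
split=> // [|x a b|a b Kb]; first exact/subK.
  (* Linear combinations pass to the closure one variable at a time, first in [b] with [k] in the
     kernel, then in [a]. *)
  have step k : K k -> closure K b -> closure K (x *: k + b).
    move=> Kk; apply: (@continuous_closure_sub _ _ (fun b => x *: k + b)) => //.
      by move=> y; apply: cvgD; [exact: cvg_cst|exact: cvg_id].
    by move=> y Ky; apply: subK; rewrite /K /= fL Kk Ky scaler0 addr0.
  move=> Ka Kb.
  apply: (@continuous_closure_sub _ _ (fun a => x *: a + b) K) => //.
    move=> y; apply: cvgD; last exact: cvg_cst.
    by apply: cvgZl_tmp; exact: cvg_id.
  by move=> y Ky; exact: step.
split.
  apply: (@continuous_closure_sub _ _ (samul a) K) => //.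
    exact: samull_continuous.
  by move=> y Ky; apply: subK; rewrite /K /= fM Ky samul0r.
apply: (@continuous_closure_sub _ _ (samul^~ a) K) => //.
  exact: samulr_continuous.
by move=> y Ky; apply: subK; rewrite /K /= fM Ky samul0l.
Qed.

End CStarAlgebra.

(** * Invertibility near the unit by the Neumann series *)

Lemma geometric_half_small (R : realType) (c e : Cplx R) : 0 <= c -> 0 < e ->
  \forall n \near \oo, c * 2^-1 ^+ n < e.
Proof.
move=> c0 e0; have r0 : 0 <= complex.Re (c / e).
  by have := divr_ge0 c0 (ltW e0); rewrite lecE /= => /andP[].
(* The Archimedean bound of the real number [c / e] suffices, as [n < 2 ^ n]. *)
exists (Num.bound (complex.Re (c / e))) => // n /= bn.
rewrite exprVn ltr_pdivrMr ?exprn_gt0// mulrC -ltr_pdivrMr//.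
rewrite -(RRe_real (ger0_real (divr_ge0 c0 (ltW e0)))).
have -> : (2 : Cplx R) ^+ n = ((2 ^ n)%:R)%:C%C.
  by rewrite natrX rmorphXn rmorph_nat.
rewrite ltcR (lt_le_trans (archi_boundP r0))// ler_nat (leq_trans bn)//.
exact: ltnW (ltn_expl _ _).
Qed.

Section Neumann.
Variables (R : realType) (A : cstarAlgType (Cplx R)).

(** The right inverse is the sum of the powers of [c = e - a]; multiplied by [a], its partial sums
    telescope to [e - p n]. *)
Lemma unit_ball_invertible (e a : A) : is_unit e -> `|e - a| <= 2^-1 ->
  exists b, samul a b = e.
Proof.
move=> e1; set c := e - a => c2.
(* [p n] is the [n]-th power of [c]. The factor [|e|] is carried through the estimates instead of
   being evaluated. *)
pose p n := iter n (samul c) e.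
have pn n : `|p n| <= `|e| * 2^-1 ^+ n.
  elim: n => [|n IH]; first by rewrite expr0 mulr1.
  rewrite /= (le_trans (normr_samul_le _ _))// exprS mulrCA.
  by rewrite ler_pM.
have sum_le m n : (m <= n)%N ->
    `|\sum_(m <= k < n) p k| <= `|e| * 2 * (2^-1 ^+ m - 2^-1 ^+ n).
  elim: n => [|n IH].
    by rewrite leqn0 => /eqP ->; rewrite big_geq// normr0 subrr mulr0.
  rewrite leq_eqVlt => /predU1P[->|].
    by rewrite big_geq// normr0 subrr mulr0.
  rewrite ltnS => mn; rewrite big_nat_recr//= (le_trans (ler_normD _ _))//.
  rewrite (le_trans (lerD (IH mn) (pn n)))// exprS.
  suff -> : `|e| * 2 * (2^-1 ^+ m - 2^-1 ^+ n) + `|e| * 2^-1 ^+ n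
    = `|e| * 2 * (2^-1 ^+ m - 2^-1 * 2^-1 ^+ n) by [].
  by field.
have scvg : cvg (series p @ \oo).
  apply: cauchy_cvg; apply/cauchy_seriesP => r r0.
  have [N _ Nr] := geometric_half_small (mulr_ge0 (normr_ge0 e) (ler0n _ 2)) r0.
  exists ([set n | N <= n]%N, [set n | N <= n]%N).
    by split; exists N.
  move=> [m n] /= [Nm Nn]; have [mn|nm] := leqP m n; last first.
    by rewrite big_geq ?normr0// ltnW.
  rewrite (le_lt_trans (sum_le _ _ mn))// (le_lt_trans _ (Nr _ Nm))//.
  by rewrite ler_wpM2l ?mulr_ge0// gerBl exprn_ge0// invr_ge0.
exists (lim (series p @ \oo)).
have as_ n : samul a (series p n) = e - p n.
  have -> : a = e - c by rewrite /c opprB addrC subrK.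
  rewrite samulBl (e1 _).1; elim: n => [|n IH].
    by rewrite /series /= big_geq// samul0r subr0 subrr.
  rewrite seriesSr/= samulDr opprD addrACA IH /p /=.
  by rewrite addrA subrK.
have as_cvg : (fun n => samul a (series p n)) @ \oo -->
    samul a (lim (series p @ \oo)).
  by apply: continuous_cvg; [exact: samull_continuous|exact: scvg].
apply: (cvg_unique (@norm_hausdorff _ A) as_cvg).
apply/cvgrPdist_lt => r r0.
have := geometric_half_small (normr_ge0 e) r0; apply: filterS => n.
by apply: le_lt_trans; rewrite as_ opprB addrC subrK.
Qed.

(** Some [k] in the kernel is within 1/2 of [e], hence has a right inverse [b]; then [a = k b a] is
    in the kernel for every [a]. *)
Lemma closure_kernel_unit_eq0 (B : starAlgType (Cplx R)) (f : A -> B) (e : A) :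
  star_hom f -> is_unit e -> closure [set a | f a = 0] e -> forall a, f a = 0.
Proof.
move=> fh e1 Ke; have [fL fM _] := fh.
have [k [fk0]] : exists k, f k = 0 /\ `|e - k| <= 2^-1.
  have [] := Ke (ball e 2^-1); first by apply: nbhsx_ballx; rewrite invr_gt0.
  by move=> k [fk0]; rewrite -ball_normE => /ltW ek; exists k.
move=> /(unit_ball_invertible e1) [b kb] a.
by rewrite -(e1 a).1 -kb !fM fk0 !samul0l.
Qed.

End Neumann.

(** Take a longest family with free image, its length being bounded by the dimension of [V]. Its
    image spans every [f a], and injectivity pulls the coordinates back to [A]. *)
Lemma finite_dimensional_inj (C : numClosedFieldType) (A : lmodType C)
    (V : vectType C) (f : A -> V) :
  (forall (x : C) a b, f (x *: a + b) = x *: f a + f b) -> injective f ->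
  finite_dimensional A.
Proof.
move=> fL finj.
have f0 : f 0 = 0.
  apply: (addrI (f 0)); rewrite addr0.
  by have := fL 1 0 0; rewrite !scale1r addr0 => <-.
pose P m := `[< exists s : seq A, size s = m /\ free (map f s) >].
have P0 : exists m, P m.
  by exists 0%N; apply/asboolP; exists [::]; rewrite nil_free.
have Pb m : P m -> (m <= \dim {:V})%N.
  move=> /asboolP[s [<- fs]]; rewrite -(size_map f) -(eqP fs).
  exact: dimvS (subvf _).
have [m /asboolP[s [sm fs]] mmax] := ex_maxnP P0 Pb.
exists s => a.
have fa : f a \in <<map f s>>%VS.
  apply: contraT => fa; suff /mmax : P m.+1 by rewrite ltnn.
  by apply/asboolP; exists (a :: s); rewrite /= sm free_cons fa.
exists (fun i => coord (map_tuple f (in_tuple s)) i (f a)); apply: finj.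
rewrite [LHS](coord_span (X := map_tuple f (in_tuple s)))//.
elim/big_rec2: _ => [|i x y _ ->]; first by rewrite f0.
by rewrite fL (nth_map 0).
Qed.

(** * Representations of the stages on a fixed matrix algebra *)

(** Each entry is an entry of a block or 0. A general predicate [P] allows use on nested block
    diagonals. *)
Lemma mxdiag_entry (V : nmodType) n (p : 'I_n -> nat)
    (B : forall i, 'M[V]_(p i)) (P : V -> Prop) :
  P 0 -> (forall i a b, P (B i a b)) -> forall a b, P (mxdiag B a b).
Proof.
move=> P0 PB a b; rewrite mxE.
move: (tagnat.sig1 b) (tagnat.sig2 b) => j c.
case: eqP c => [<-|_] c; last by rewrite mxE.
by rewrite conform_mx_id.
Qed.

Lemma min_blk_size_attained (R : realType) (D : block_data R) :
  exists l, min_blk_size D = blk_size D l.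
Proof.
rewrite /min_blk_size; elim/big_ind: _ => [|x y [l ->] [l' ->]|l _].
(* The starting value of the minimum is a maximum, itself attained because there is at least one
   block. *)
- have [|l lE] := @bigop.eq_bigmax _ (blk_size D); last by exists l.
  by rewrite card_ord blk_count_gt0.
- by rewrite /minn; case: ifP => _; [exists l|exists l'].
- by exists l.
Qed.

(** This bound stands in for a norm on the stages: diagonal maps preserve it, since they only
    rearrange values of entries and insert zeros. *)
Definition entries_le (R : realType) (D : block_data R) (f : block_alg D)
    (B : Cplx R) : Prop :=
  forall l x a b, `|f l x a b| <= B.

Lemma entries_bounded (R : realType) (D : block_data R) (f : block_alg D) :
  exists n : nat, entries_le f n%:R.
Proof.
suff /filter_ex[n fn] : \forall n \near \oo, forall l a b x,
    `|f l x a b| <= n%:R by exists n => l x a b; exact: fn.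
apply: filter_forall => l; apply: filter_forall => a; apply: filter_forall => b.
have : \forall n \near \oo, [set: blk_space D l] `<=`
    (fun x => `|f l x a b| <= n%:R).
  move: (@blk_compact R D l) => /compact_near_coveringP; apply => x _.
  (* The extra 1 absorbs the variation of the entry on a neighbourhood of [x]. *)
  have [N fN] : exists N, `|f l x a b| + 1 <= N%:R.
    have f0 : 0 <= `|f l x a b| + 1 by rewrite addr_ge0.
    have r0 : 0 <= complex.Re (`|f l x a b| + 1).
      by move: f0; rewrite lecE /= => /andP[].
    exists (Num.bound (complex.Re (`|f l x a b| + 1))).
    rewrite -(RRe_real (ger0_real f0)) -(rmorph_nat (real_complex R)) lecR.
    by rewrite ltW// archi_boundP.
  have fx : \forall x' \near x, `|f l x a b - f l x' a b| < 1.
    have := @block_coord_continuous _ _ f l a b x.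
    by move=> /cvgrPdist_lt/(_ _ ltr01).
  exists ([set x' | `|f l x a b - f l x' a b| < 1], [set n | N <= n]%N).
    by split => //; exists N.
  move=> [x' n] /= [xx' Nn]; rewrite (@le_trans _ _ N%:R) ?ler_nat//.
  rewrite (le_trans _ fN)// -lerBlDl (le_trans (lerB_dist _ _))//.
  by rewrite distrC ltW.
by apply: filterS => n fn x; exact: fn.
Qed.

(** The last clause has the same bound for all representations, which gives limits along an
    ultrafilter; the unit clause keeps these limits nonzero when [d] is positive. *)
Definition contractive_rep (R : realType) (D : block_data R) d
    (g : block_alg D -> opmx R d) : Prop :=
  [/\ star_hom g, g (@block_one R D) = 1%:M
    & forall f B, 0 <= B -> entries_le f B ->
        forall a b, `|g f a b : Cplx R| <= B].

Lemma evaluation_contractive (R : realType) (D : block_data R) l :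
  exists g : block_alg D -> opmx R (blk_size D l), contractive_rep g.
Proof.
have [x _] := blk_nonempty l.
by exists (fun f => f l x); split=> // f B _ fB a b; exact: fB.
Qed.

Lemma diagonal_hom_entries_le (R : realType) (D E : block_data R)
    (phi : block_alg D -> block_alg E) f (B : Cplx R) :
  diagonal_hom phi -> 0 <= B -> entries_le f B -> entries_le (phi f) B.
Proof.
move=> [_ phiE] B0 fB j y a b; have [k [e [lam ->]]] := phiE j.
rewrite castmxE; apply: (mxdiag_entry (P := fun z => `|z| <= B)) => [|l {}a {}b].
  by rewrite normr0.
apply: (mxdiag_entry (P := fun z => `|z| <= B)) => [|r {}a {}b].
  by rewrite normr0.
exact: fB.
Qed.

Lemma is_unit_block_one (R : realType) (D : block_data R) (e : block_alg D) :
  is_unit e -> e = @block_one R D.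
Proof.
by move=> e1; rewrite -[LHS](block_one_unit e).2; exact: (e1 _).1.
Qed.

Lemma contractive_rep_comp (R : realType) (D E : block_data R) d
    (phi : block_alg D -> block_alg E) (g : block_alg E -> opmx R d) :
  diagonal_hom phi -> contractive_rep g -> contractive_rep (g \o phi).
Proof.
move=> phid [[gL gM gS] g1 gB]; have [[[pL pM pS] p1] _] := phid; split.
- by split=> * /=; rewrite ?pL ?pM ?pS ?gL ?gM ?gS.
- by rewrite /= (is_unit_block_one (p1 _ (@block_one_unit _ D))).
- move=> f B B0 fB a b; apply: gB => //.
  exact: diagonal_hom_entries_le.
Qed.

Section Pullback.
Variables (R : realType) (S : diagonal_ah_system R) (d : nat).

(* [h (i + k)] composed with the connecting map A_i -> A_(i+k); composing on the
   right avoids casts between the stages [i + k.+1] and [i.+1 + k]. *)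
Fixpoint pullback k (h : forall n, block_alg (ah_data S n) -> opmx R d) i :
    block_alg (ah_data S i) -> opmx R d :=
  if k is k'.+1 then pullback k' h (i := i.+1) \o @ah_map R S i else h i.

Lemma pullback_contractive k h i :
  contractive_rep (D := ah_data S (i + k)) (@h (i + k)%N) ->
  contractive_rep (D := ah_data S i) (@pullback k h i).
Proof.
elim: k i => [|k IH] i; first by rewrite addn0.
(* Reading [i + k.+1] as [i.+1 + k] allows the induction hypothesis at [i.+1]. *)
rewrite -addSnnS => /IH; apply: contractive_rep_comp.
exact: ah_map_diagonal.
Qed.

End Pullback.

Lemma conj_continuous (C : numClosedFieldType) : continuous (@Num.conj C).
Proof.
apply: (@lipschitz_continuous C C C _ 1) => // x y.
by rewrite mul1r -rmorphB norm_conjC.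
Qed.

(** * The limit of a family of representations along an ultrafilter *)

Section UltraLimit.
Variables (R : realType) (S : diagonal_ah_system R) (d : nat).
Variables (F : set_system nat) (FU : UltraFilter F).
Variable rep : forall n i : nat, block_alg (ah_data S i) -> opmx R d.
Hypothesis repP : forall i, \forall n \near F,
  contractive_rep (D := ah_data S i) (@rep n i).
Hypothesis rep_map : forall i (f : block_alg (ah_data S i)),
  \forall n \near F, rep n (ah_map f) = rep n f.
Local Notation C := (Cplx R).

Definition limit_rep i (f : block_alg (ah_data S i)) : opmx R d :=
  \matrix_(a, b) lim ((fun n => rep n f a b : C) @ F).

Lemma limit_rep_cvg i (f : block_alg (ah_data S i)) a b :
  (fun n => rep n f a b : C) @ F --> (limit_rep f a b : C).
Proof.
rewrite mxE; have [m fm] := entries_bounded f.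
apply: (@bounded_ultra_cvg _ _ _ _ m%:R).
by apply: filterS (repP i) => n [_ _]; apply.
Qed.

(** By uniqueness of limits, any identity valid for [F]-almost all [n] passes to [limit_rep], once
    its right-hand side converges entrywise. *)
Lemma limit_repE i (f : block_alg (ah_data S i)) (u : nat -> opmx R d)
    (L : opmx R d) : (\forall n \near F, rep n f = u n) ->
  (forall a b, (fun n => u n a b : C) @ F --> (L a b : C)) -> limit_rep f = L.
Proof.
move=> fu uL; apply/matrixP => a b.
apply: (cvg_unique (@norm_hausdorff _ C) (@limit_rep_cvg _ f a b)).
apply: cvg_trans (uL a b); apply: near_eq_cvg.
by apply: filterS fu => n ->.
Qed.

Lemma limit_rep_star_hom i : star_hom (@limit_rep i).
Proof.
split=> [x f g|f g|f].
- apply: (@limit_repE _ _ (fun n => x *: rep n f + rep n g)).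
    by apply: filterS (repP i) => n [[gL _ _] _ _]; exact: gL.
  move=> a b; rewrite opmx_linE; under eq_fun do rewrite opmx_linE.
  apply: cvgD; last exact: limit_rep_cvg.
  by apply: cvgMl_tmp; exact: limit_rep_cvg.
- apply: (@limit_repE _ _ (fun n => samul (rep n f) (rep n g))).
    by apply: filterS (repP i) => n [[_ gM _] _ _]; exact: gM.
  move=> a b; rewrite mxE; under eq_fun do rewrite mxE.
  apply: cvg_big => [|k _]; first exact: add_continuous.
  by apply: cvgM; exact: limit_rep_cvg.
- apply: (@limit_repE _ _ (fun n => sastar (rep n f))).
    by apply: filterS (repP i) => n [[_ _ gS] _ _]; exact: gS.
  move=> a b; rewrite 2!mxE; under eq_fun do rewrite 2!mxE.
  by apply: continuous_cvg; [exact: conj_continuous|exact: limit_rep_cvg].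
Qed.

Lemma limit_rep1 i : limit_rep (@block_one R (ah_data S i)) = 1%:M.
Proof.
apply: (@limit_repE _ _ (fun=> 1%:M)) => [|a b]; last exact: cvg_cst.
by apply: filterS (repP i) => n [].
Qed.

Lemma limit_rep_map i (f : block_alg (ah_data S i)) :
  limit_rep (ah_map f) = limit_rep f.
Proof.
apply: limit_repE (rep_map f) _ => a b; exact: limit_rep_cvg.
Qed.

End UltraLimit.

(** The number [d] is the limit inferior of [m]: if [d.+1] is the least [A] that is not eventually a
    lower bound, then [d <= m n] eventually, and [m n] cannot eventually avoid [d]. *)
Lemma not_cvgny_frequently (m : nat -> nat) : ~ (m @ \oo --> \oo) ->
  exists d, ~ \forall n \near \oo, m n <> d.
Proof.
move=> mNoo; have [A NA] : exists A, ~ \forall n \near \oo, (A <= m n)%N.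
  by apply/existsNP => mA; apply: mNoo; exact/cvgnyPge.
have exA : exists A, `[< ~ \forall n \near \oo, (A <= m n)%N >].
  by exists A; exact/asboolP.
case: (ex_minnP exA) => -[|B] /asboolP NB Bmin.
  by case: NB; exact: nearW.
exists B => NmB; apply: NB.
have : \forall n \near \oo, (B <= m n)%N.
  by apply: contrapT => /asboolP/Bmin; rewrite ltnn.
by apply: filterS2 NmB => n mB; rewrite leq_eqVlt => /predU1P[/esym|].
Qed.

(** Restricting the filter [\oo] to [E] leaves it proper, so it extends to an ultrafilter. *)
Lemma frequently_ultrafilter (E : set nat) : ~ (\forall n \near \oo, ~ E n) ->
  exists F : set_system nat, [/\ UltraFilter F, \oo `<=` F & F E].
Proof.
move=> NE; have : ProperFilter (within E \oo).
  split; last exact: within_filter.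
  by move=> E0; apply: NE.
move=> /ultraFilterLemma[F [FU EF]]; exists F; split=> //.
  by move=> P ooP; apply: EF; apply: filterS ooP => n Pn _.
by apply: EF; apply: nearW.
Qed.

Lemma stationary_rep (R : realType) (S : diagonal_ah_system R) :
  ~ (fun i => min_blk_size (ah_data S i)) @ \oo --> \oo ->
  exists (d : nat) (nu : forall i, ah_stage S i -> opmx R d),
    [/\ (0 < d)%N, forall i, star_hom (nu i),
        forall i f, nu i.+1 (ah_map f) = nu i f
      & forall i, nu i (@block_one R (ah_data S i)) = 1%:M].
Proof.
move=> /not_cvgny_frequently[d NE].
have [F [FU ooF FE]] := frequently_ultrafilter NE.
have d_gt0 : (0 < d)%N.
  have [n <-] := filter_ex FE.
  by have [l ->] := min_blk_size_attained (ah_data S n); exact: blk_size_gt0.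
have exh n : exists h : block_alg (ah_data S n) -> opmx R d,
    min_blk_size (ah_data S n) = d ->
    contractive_rep (D := ah_data S n) h.
  have [<-|nd] := eqVneq (min_blk_size (ah_data S n)) d; last first.
    (* A default value at the other stages; their indices are negligible for [F]. *)
    by exists (fun=> 0) => /eqP; rewrite (negPf nd).
  have [l ->] := min_blk_size_attained (ah_data S n).
  by have [g gP] := evaluation_contractive l; exists g.
pose h n := projT1 (cid (exh n)).
have hP n := projT2 (cid (exh n)).
(* The truncated difference is meaningful only for [i <= n], which holds for [F]-almost all [n]. *)
pose rep n i := pullback (n - i) h (i := i).
have repP i : \forall n \near F,
    contractive_rep (D := ah_data S i) (@rep n i).
  apply: filterS2 FE (ooF _ (nbhs_infty_ge i)) => n nd i_n.
  by apply: pullback_contractive; apply: hP; rewrite subnKC.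
have rep_map i (f : block_alg (ah_data S i)) :
    \forall n \near F, rep n i.+1 (ah_map f) = rep n i f.
  apply: filterS (ooF _ (nbhs_infty_gt i)) => n i_n.
  (* For [i < n], [n - i] is the successor of [n - i.+1], so [pullback] unfolds by one connecting
     map. *)
  by rewrite /rep -(subnSK i_n).
exists d, (limit_rep F rep); split=> //.
- by move=> i; exact: limit_rep_star_hom.
- by move=> i f; exact: limit_rep_map.
- by move=> i; exact: limit_rep1.
Qed.

Theorem proposition3p9 (R : realType) (S : diagonal_ah_system R)
    (A : cstarAlgType (Cplx R)) (mu : forall i, ah_stage S i -> A)
    (A_lim : inductive_limit (A_ := ah_stage S) (@ah_map R S) mu)
    (A_simple : simple_cstar A)
    (A_unital : unital A)
    (A_infdim : ~ finite_dimensional A) :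
  (fun i => min_blk_size (ah_data S i)) @ \oo --> \oo.
Proof.
apply: contrapT => /stationary_rep[d [nu [d_gt0 nuh nu_map nu1]]].
(* The universal property applies because [opmx R d] is a C*-algebra. *)
have [_ _ /(_ (opmx R d) nu nuh nu_map)[psi [[psih psi_mu] _]]] := A_lim.
have [psiL _ _] := psih.
have [e e1] := A_unital.
have [_ /(_ _ (closure_kernel_ideal psih))[ker0|kerT]] := A_simple.
  (* If the closure of the kernel is zero, [psi] embeds [A] linearly into the matrices of size
     [d]. *)
  apply: A_infdim; apply: (@finite_dimensional_inj _ _ 'M[Cplx R]_d psi) => //.
  move=> a b psiab; apply/eqP; rewrite -subr_eq0; apply/eqP.
  suff : closure [set a | psi a = 0] (a - b) by rewrite ker0.
  apply: subset_closure; rewrite /= addrC -scaleN1r psiL psiab scaleN1r.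
  by rewrite addNr.
have psi0 : forall a, psi a = 0.
  by apply: closure_kernel_unit_eq0 e1 _ => //; rewrite kerT.
(* Otherwise [psi] vanishes, yet the unit of the first stage goes to [1%:M], nonzero as [d] is
   positive. *)
have := nu1 0%N; rewrite -psi_mu psi0 => /matrixP/(_ (Ordinal d_gt0)).
by move=> /(_ (Ordinal d_gt0))/eqP; rewrite !mxE eqxx eq_sym oner_eq0.
Qed.
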